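(* Let $n=2^m m'$, where $m\in\mathbb{N}=\{0,1,2,\dots\}$ and $m'$ is a positive odd integer, and let $m'=p_1^{\alpha_1}p_2^{\alpha_2}\cdots p_k^{\alpha_k}$ be the prime factorization of $m'$. Then the subgroup commutativity degree of the dicyclic group $Dic_{4n}$ is $$sd(Dic_{4n})=\frac{(m+2)^2\tau(m')^2+2(m+2)\tau(m')\sigma(n)+[(m-1)2^{m+3}+9]\,g(m')}{[(m+2)\tau(m')+\sigma(n)]^2},$$ where $$g(m')=\prod_{i=1}^k\frac{(2\alpha_i+1)p_i^{\alpha_i+2}-(2\alpha_i+3)p_i^{\alpha_i+1}+p_i+1}{(p_i-1)^2}$$ (an empty product, i.e. $m'=1$, being equal to $1$).
   Context: For a finite group $G$, $L(G)$ denotes the set of all subgroups of $G$, and the subgroup commutativity degree is $sd(G)=\frac{1}{|L(G)|^2}\,\bigl|\{(H,K)\in L(G)^2 : HK=KH\}\bigr|$. For a positive integer $n$, $\tau(n)$ is the number of positive divisors of $n$ and $\sigma(n)$ is their sum. The dicyclic group of order $4n$ ($n\geq 1$) is $Dic_{4n}=\langle a,\gamma \mid a^{2n}=e,\ \gamma^2=a^n,\ \gamma^{-1}a\gamma=a^{-1}\rangle$. *)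

(* Defs.v *)
From mathcomp Require Import all_boot all_order all_algebra all_fingroup.
Set Implicit Arguments. Unset Strict Implicit. Unset Printing Implicit Defensive.
Import GRing.Theory Num.Theory.

Definition sd (gT : finGroupType) (G : {set gT}) : rat :=
  (#|[set HK in setX (subgroups G) (subgroups G)
        | ((HK.1 : {set gT}) * HK.2 == HK.2 * HK.1)%g]|%:R
   / (#|subgroups G| ^ 2)%:R)%R.

Definition tau (n : nat) : nat := size (divisors n).
Definition sigma (n : nat) : nat := \sum_(d <- divisors n) d.

Definition gfun (m' : nat) : rat :=
  (\prod_(p <- primes m')
     let a := logn p m' in
     (((2 * a + 1) * p ^ (a + 2))%:R - ((2 * a + 3) * p ^ (a + 1))%:R + p%:R + 1)
       / ((p%:R - 1) ^+ 2))%R.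

(* Main.v *)
Require Import Defs.
From mathcomp Require Import all_boot all_order all_algebra all_fingroup all_solvable.
From mathcomp Require Import zify ring.
Import GRing.Theory Num.Theory.

(* The subgroups of <a> are normal, hence permute with everything; there are
   tau(2n) of them.  The other subgroups are D(d,i) = <a^d> U <a^d> a^i c with
   d | n and 0 <= i < d, sigma(n) in all.  The commutator of a^i c and a^j c is
   a^(2(i-j)) up to inversion, so D(d,i) and D(e,j) permute iff
   2i = 2j mod gcd(d,e).  For fixed d, e this holds for lcm(d,e) pairs (i,j) if
   gcd(d,e) is odd and for 2 lcm(d,e) pairs otherwise; the sum over d, e | n is
   multiplicative, and is computed prime by prime.  That a and c satisfy no
   further relation is seen on a permutation group of order at least 4n. *)

(** * Divisors of a product of two coprime numbers *)

Lemma gcdn_coprime_mull x y d e : coprime x y -> d %| x -> e %| y ->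
  gcdn (d * e) x = d.
Proof.
move=> cxy dx ey.
rewrite gcdnC Gauss_gcdl ?(coprime_dvdr ey) // gcdnC.
by apply/gcdn_idPl.
Qed.

(** The factors are [g = gcdn z x] and [z %/ g]: the latter divides [(x %/ g) * y] and is coprime to
    [x %/ g]. *)
Lemma dvdn_coprimeM x y z : 0 < z -> coprime x y -> z %| x * y ->
  exists d e, [/\ d %| x, e %| y & z = d * e].
Proof.
move=> z_gt0 cxy zxy; exists (gcdn z x), (z %/ gcdn z x).
have zz : z = gcdn z x * (z %/ gcdn z x) by rewrite mulnC divnK ?dvdn_gcdl.
split=> //; first exact: dvdn_gcdr.
have g_gt0 : 0 < gcdn z x by rewrite gcdn_gt0 z_gt0.
have : gcdn z x * (z %/ gcdn z x) %| x %/ gcdn z x * gcdn z x * y.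
  by rewrite -zz divnK ?dvdn_gcdr.
rewrite mulnAC [_ * gcdn z x]mulnC.
rewrite dvdn_pmul2l // Gauss_dvdr //.
rewrite /coprime -(eqn_pmul2l g_gt0) muln_gcdr muln1 -zz.
by rewrite mulnC divnK ?dvdn_gcdr.
Qed.

(** Multiplication of a divisor of [x] by one of [y] is injective, since [d] is recovered as the gcd
    of [d * e] and [x]; it is onto by [dvdn_coprimeM]. *)
Lemma perm_divisorsM x y : 0 < x -> 0 < y -> coprime x y ->
  perm_eq (divisors (x * y)) [seq d * e | d <- divisors x, e <- divisors y].
Proof.
move=> x0 y0 cxy; have xy0 : 0 < x * y by rewrite muln_gt0 x0.
apply: uniq_perm; first exact: divisors_uniq.
  apply: allpairs_uniq; rewrite ?divisors_uniq // => -[d e] [d' e'].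
  move=> /allpairsP[[d1 e1] /= [dx ey [-> ->]]] /allpairsP[[d2 e2] /= [dx' ey' [-> ->]]].
  move: dx ey dx' ey'; rewrite -!dvdn_divisors // => dx ey dx' ey' E.
  have Ed : d1 = d2.
    by rewrite -(gcdn_coprime_mull _ _ _ _ cxy dx ey) E (gcdn_coprime_mull x y).
  congr (_, _) => //; move: E; rewrite Ed => /eqP.
  by rewrite eqn_pmul2l ?(dvdn_gt0 x0) // => /eqP.
move=> z; rewrite -dvdn_divisors //; apply/idP/allpairsP.
  move=> zxy; have z0 := dvdn_gt0 xy0 zxy.
  have [d [e [dx ey ->]]] := dvdn_coprimeM _ _ _ z0 cxy zxy.
  by exists (d, e); rewrite -!dvdn_divisors.
by case=> -[d e] /=; rewrite -!dvdn_divisors // => -[dx ey ->]; apply: dvdn_mul.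
Qed.

Lemma big_divisorsM (F : nat -> nat) x y : 0 < x -> 0 < y -> coprime x y ->
  \sum_(d <- divisors (x * y)) F d =
  \sum_(d <- divisors x) \sum_(e <- divisors y) F (d * e).
Proof.
by move=> x0 y0 cxy; rewrite (perm_big _ (perm_divisorsM _ _ x0 y0 cxy)) big_allpairs_dep.
Qed.

Lemma big_divisors_pfactor (F : nat -> nat) p k : prime p ->
  \sum_(d <- divisors (p ^ k)) F d = \sum_(i < k.+1) F (p ^ i).
Proof.
move=> pp; have pk0 : 0 < p ^ k by rewrite expn_gt0 prime_gt0.
rewrite (@perm_big _ _ _ _ _ [seq p ^ i | i <- iota 0 k.+1]).
  by rewrite big_map -(big_mkord xpredT (fun i => F (p ^ i))) /index_iota subn0.
apply: uniq_perm; first exact: divisors_uniq.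
  by rewrite map_inj_uniq ?iota_uniq //; apply: expnI; apply: prime_gt1.
move=> d; rewrite -dvdn_divisors //; apply/(dvdn_pfactor _ _ pp)/mapP.
  by case=> i ik ->; exists i; rewrite // mem_iota.
by case=> i; rewrite mem_iota add0n => /= ik ->; exists i.
Qed.

Lemma tau_sum n : tau n = \sum_(d <- divisors n) 1.
Proof. by rewrite sum1_size. Qed.

Lemma tauM x y : 0 < x -> 0 < y -> coprime x y -> tau (x * y) = tau x * tau y.
Proof.
move=> x0 y0 cxy; rewrite !tau_sum big_divisorsM // big_distrl /=.
by apply: eq_bigr => d _; rewrite mul1n.
Qed.

Lemma tau_pfactor p k : prime p -> tau (p ^ k) = k.+1.
Proof. by move=> pp; rewrite tau_sum big_divisors_pfactor // sum1_card card_ord. Qed.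

Lemma gcdn_mul_coprime x y d e d' e' : 0 < x -> 0 < y ->
  coprime x y -> d %| x -> d' %| x -> e %| y -> e' %| y ->
  gcdn (d * e) (d' * e') = gcdn d d' * gcdn e e'.
Proof.
move=> x0 y0 cxy dx dx' ey ey'; apply/eqP.
rewrite eqn_dvd dvdn_gcd !dvdn_mul ?dvdn_gcdl ?dvdn_gcdr //.
(* For the remaining divisibility, split the gcd of the products as [u * v]. Since [u] is coprime to
   [e] and [e'], it divides [d] and [d']; symmetrically, [v] divides [e] and [e']. *)
have [|||u [v [ux vy E]]] := dvdn_coprimeM x y (gcdn (d * e) (d' * e')) => //.
- by rewrite gcdn_gt0 muln_gt0 (dvdn_gt0 x0 dx) (dvdn_gt0 y0 ey).
- by rewrite (dvdn_trans (dvdn_gcdl _ _)) // dvdn_mul.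
have cop a b : a %| x -> b %| y -> coprime a b.
  by move=> ax yb; rewrite (coprime_dvdl ax) // (coprime_dvdr yb).
have [h1 h2] : u * v %| d * e /\ u * v %| d' * e'.
  by rewrite -E dvdn_gcdl dvdn_gcdr.
rewrite E !andbT; apply: dvdn_mul; rewrite dvdn_gcd; apply/andP; split.
- by rewrite -(Gauss_dvdl _ (cop u e ux ey)) (dvdn_trans _ h1) ?dvdn_mulr.
- by rewrite -(Gauss_dvdl _ (cop u e' ux ey')) (dvdn_trans _ h2) ?dvdn_mulr.
- by rewrite -(@Gauss_dvdr _ d) 1?coprime_sym ?cop // (dvdn_trans _ h1) ?dvdn_mull.
- by rewrite -(@Gauss_dvdr _ d') 1?coprime_sym ?cop // (dvdn_trans _ h2) ?dvdn_mull.
Qed.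

Lemma lcmn_mul_coprime x y d e d' e' : 0 < x -> 0 < y ->
  coprime x y -> d %| x -> d' %| x -> e %| y -> e' %| y ->
  lcmn (d * e) (d' * e') = lcmn d d' * lcmn e e'.
Proof.
move=> x0 y0 cxy dx dx' ey ey'.
have d0 := dvdn_gt0 x0 dx; have e0 := dvdn_gt0 y0 ey.
apply/eqP; rewrite -(@eqn_pmul2r (gcdn (d * e) (d' * e'))) ?gcdn_gt0 ?muln_gt0 ?d0 ?e0 //.
rewrite muln_lcm_gcd (gcdn_mul_coprime x y) // [eqbRHS]mulnACA !muln_lcm_gcd.
by rewrite mulnACA.
Qed.

(** * Counting the solutions of [2i = 2j] modulo a gcd *)

Lemma sum_eqmod h e r : 0 < h -> h %| e ->
  \sum_(i < e) (i == r %[mod h]) = e %/ h.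
Proof.
move=> h0 /dvdnP[q ->{e}]; rewrite mulnK //.
elim: q => [|q IHq]; first by rewrite mul0n big_ord0.
rewrite mulSn big_split_ord /= (eq_bigr (fun i : 'I_h => (i == r %% h :> nat) : nat)).
  rewrite (bigD1 (Ordinal (ltn_pmod r h0))) //= eqxx big1 ?addn0.
    by under eq_bigr do rewrite modnDl; rewrite IHq.
  by move=> i; rewrite -val_eqE /= => /negbTE->.
by move=> i _; rewrite modn_small.
Qed.

(** Modulo an odd [g], 2 can be cancelled; for an even [g], the modulus is halved along with both
    sides. *)
Lemma eqmod_double i j g : 0 < g ->
  (2 * i == 2 * j %[mod g]) = (i == j %[mod if odd g then g else g./2]).
Proof.
move=> g0; wlog le_ij: i j / i <= j.
  by move=> W; case: (leqP i j) => [/W//|/ltnW/W]; rewrite eq_sym => ->; rewrite eq_sym.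
rewrite eq_sym eqn_mod_dvd ?leq_mul2l // -mulnBr [RHS]eq_sym eqn_mod_dvd //.
case: ifP => og; first by rewrite Gauss_dvdr // coprimen2.
by rewrite -{1}(even_halfK (negbT og)) -muln2 mulnC dvdn_pmul2l.
Qed.

Lemma sum_eqmod_double d e : 0 < d -> 0 < e ->
  \sum_(i < d) \sum_(j < e) (2 * i == 2 * j %[mod gcdn d e]) =
  lcmn d e * (if 2 %| gcdn d e then 2 else 1).
Proof.
move=> d0 e0; have g0 : 0 < gcdn d e by rewrite gcdn_gt0 d0.
set g := gcdn d e in g0 *.
(* The condition is [i = j] modulo [h], and [h] divides [e], so each [i] has [e %/ h] partners. The
   total [d * e / h] is [lcmn d e] times [g / h], which is 1 or 2. *)
pose h := if odd g then g else g./2.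
have hg : h * (if 2 %| g then 2 else 1) = g.
  rewrite dvdn2 /h; case: ifP => og /=; first by rewrite muln1.
  by rewrite muln2 even_halfK ?og.
have h0 : 0 < h by move: g0; rewrite -hg muln_gt0; case: (h).
have hd : h %| e by rewrite (dvdn_trans _ (dvdn_gcdr d e)) // -/g -hg dvdn_mulr.
rewrite (eq_bigr (fun=> e %/ h)) => [|i _]; last first.
  under eq_bigr => j _ do rewrite eqmod_double // eq_sym -/h.
  exact: sum_eqmod.
rewrite sum_nat_const card_ord; apply/eqP.
rewrite -(eqn_pmul2r h0) -mulnA divnK // -mulnA [_ * h]mulnC hg.
by rewrite muln_lcm_gcd.
Qed.

(** * Sums of lcms over pairs of divisors *)

Definition lcm_sum n := \sum_(d <- divisors n) \sum_(e <- divisors n) lcmn d e.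

(* The weight is the number of solutions found in [sum_eqmod_double]. *)
Definition dbl_lcm_sum n := \sum_(d <- divisors n) \sum_(e <- divisors n)
   lcmn d e * (if 2 %| gcdn d e then 2 else 1).

Lemma lcm_sumM x y : 0 < x -> 0 < y -> coprime x y ->
  lcm_sum (x * y) = lcm_sum x * lcm_sum y.
Proof.
move=> x0 y0 cxy; rewrite /lcm_sum big_divisorsM // big_distrl /=.
apply: eq_big_seq => d; rewrite -dvdn_divisors // => dx.
under [LHS]eq_bigr => e _ do rewrite big_divisorsM //.
rewrite exchange_big big_distrl /=.
apply: eq_big_seq => d'; rewrite -dvdn_divisors // => dx'.
rewrite big_distrr /=.
apply: eq_big_seq => e; rewrite -dvdn_divisors // => ey.
rewrite big_distrr /=.
apply: eq_big_seq => e'; rewrite -dvdn_divisors // => ey'.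
exact: lcmn_mul_coprime cxy _ _ _ _.
Qed.

(** Divisors of [y] have odd gcds, so the weight depends on the powers of 2 alone and stays with the
    first factor. *)
Lemma dbl_lcm_sumM m y : odd y ->
  dbl_lcm_sum (2 ^ m * y) = dbl_lcm_sum (2 ^ m) * lcm_sum y.
Proof.
move=> oy; have y0 := odd_gt0 oy; have x0 : 0 < 2 ^ m by rewrite expn_gt0.
have cxy : coprime (2 ^ m) y by rewrite coprimeXl // coprime2n.
rewrite /dbl_lcm_sum /lcm_sum big_divisorsM // big_distrl /=.
apply: eq_big_seq => d; rewrite -dvdn_divisors // => dx.
under [LHS]eq_bigr => e _ do rewrite big_divisorsM //.
rewrite exchange_big big_distrl /=.
apply: eq_big_seq => d'; rewrite -dvdn_divisors // => dx'.
rewrite big_distrr /=.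
apply: eq_big_seq => e; rewrite -dvdn_divisors // => ey.
rewrite big_distrr /=.
apply: eq_big_seq => e'; rewrite -dvdn_divisors // => ey'.
rewrite (lcmn_mul_coprime (2 ^ m) y) // (gcdn_mul_coprime (2 ^ m) y) //.
have og : odd (gcdn e e') by rewrite (dvdn_odd (dvdn_gcdl e e')) // (dvdn_odd ey).
by rewrite Gauss_dvdl ?coprime2n // mulnAC.
Qed.

Lemma big_ord2_recr (F : nat -> nat -> nat) k :
  \sum_(i < k.+1) \sum_(j < k.+1) F i j =
  \sum_(i < k) \sum_(j < k) F i j + \sum_(i < k) (F i k + F k i) + F k k.
Proof.
rewrite big_ord_recr /= big_ord_recr /= addnA; congr (_ + _).
rewrite big_split /= addnA; congr (_ + _).
by rewrite -big_split /=; apply: eq_bigr => i _; rewrite big_ord_recr.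
Qed.

(** The new pairs are those with [p ^ k.+1] in some coordinate: there are [2 * k + 3], all of lcm
    [p ^ k.+1]. *)
Lemma lcm_sum_pfactorS p k : prime p ->
  lcm_sum (p ^ k.+1) = lcm_sum (p ^ k) + (2 * k + 3) * p ^ k.+1.
Proof.
move=> pp; rewrite /lcm_sum.
under eq_bigr do rewrite big_divisors_pfactor //.
under [in RHS]eq_bigr do rewrite big_divisors_pfactor //.
rewrite !big_divisors_pfactor // (big_ord2_recr (fun i j => lcmn (p ^ i) (p ^ j))).
rewrite -addnA; congr (_ + _); rewrite (lcmn_idPl (dvdnn _)).
rewrite (eq_bigr (fun=> 2 * p ^ k.+1)); first by rewrite sum_nat_const card_ord; lia.
move=> i _; have /lcmn_idPl h : p ^ i %| p ^ k.+1 by rewrite dvdn_exp2l // ltnW.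
by rewrite h lcmnC h; lia.
Qed.

(** Of the [2 * k + 3] new pairs, the two containing 1 have weight 1 and the other [2 * k + 1] have
    weight 2, in total [4 * k + 4]. *)
Lemma dbl_lcm_sum_pow2S k :
  dbl_lcm_sum (2 ^ k.+1) = dbl_lcm_sum (2 ^ k) + (4 * k + 4) * 2 ^ k.+1.
Proof.
rewrite /dbl_lcm_sum.
under eq_bigr do rewrite big_divisors_pfactor //.
under [in RHS]eq_bigr do rewrite big_divisors_pfactor //.
rewrite !big_divisors_pfactor // (big_ord2_recr (fun i j => lcmn (2 ^ i) (2 ^ j) *
  (if 2 %| gcdn (2 ^ i) (2 ^ j) then 2 else 1))).
rewrite -addnA; congr (_ + _).
rewrite (lcmn_idPl (dvdnn _)) gcdnn expnS dvdn_mulr // -expnS.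
rewrite (eq_bigr (fun i : 'I__ => 2 * 2 ^ k.+1 * (if i == 0 :> nat then 1 else 2))).
  rewrite big_ord_recl /= (eq_bigr (fun=> 2 * 2 ^ k.+1 * 2)) //.
  by rewrite sum_nat_const card_ord; lia.
move=> i _; have dik : 2 ^ i %| 2 ^ k.+1 by rewrite dvdn_exp2l // ltnW.
rewrite [lcmn (2 ^ i) _]lcmnC [gcdn (2 ^ k.+1) _]gcdnC.
rewrite (lcmn_idPl dik) (gcdn_idPl dik).
by case: (i : nat) => [|j]; rewrite ?expnS ?dvdn_mulr //=; lia.
Qed.

Lemma dbl_lcm_sum_pow2E m :
  ((dbl_lcm_sum (2 ^ m))%:R = (m%:R - 1) * (2 ^ (m + 3))%:R + 9 :> rat)%R.
Proof.
elim: m => [|m IHm]; first by rewrite /dbl_lcm_sum expn0 !big_seq1.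
rewrite dbl_lcm_sum_pow2S natrD IHm !natrM natrD natrM !natrX !exprD !exprS.
by rewrite -natr1; ring.
Qed.

Lemma lcm_sum_pfactor p k : prime p ->
  ((lcm_sum (p ^ k))%:R =
   (((2 * k + 1) * p ^ (k + 2))%:R - ((2 * k + 3) * p ^ (k + 1))%:R + p%:R + 1)
       / ((p%:R - 1) ^+ 2) :> rat)%R.
Proof.
move=> pp.
have p1 : (p%:R - 1 != 0 :> rat)%R.
  by rewrite subr_eq0 pnatr_eq1 neq_ltn prime_gt1 ?orbT.
elim: k => [|k IHk].
  rewrite /lcm_sum expn0 !big_seq1.
  by rewrite muln0 !add0n mul1n natrM !natrX (lcmn_idPl (dvdnn _)); field.
rewrite lcm_sum_pfactorS // natrD IHk !natrM !natrD !natrM !natrX !exprD !exprS -natr1.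
by field.
Qed.

Lemma lcm_sum1 : lcm_sum 1 = 1.
Proof. by rewrite /lcm_sum !big_seq1. Qed.

Lemma lcm_sum_prod (s : seq nat) (k : nat -> nat) : uniq s -> all prime s ->
  lcm_sum (\prod_(p <- s) p ^ k p) = \prod_(p <- s) lcm_sum (p ^ k p).
Proof.
elim: s => [|p s IHs]; first by rewrite !big_nil lcm_sum1.
rewrite !big_cons /= => /andP[ps us] /andP[pp pr_s].
have prod_gt0 : 0 < \prod_(q <- s) q ^ k q.
  rewrite big_seq prodn_cond_gt0 // => q qs.
  by rewrite expn_gt0 prime_gt0 ?(allP pr_s).
rewrite lcm_sumM ?IHs //; first by rewrite expn_gt0 prime_gt0.
rewrite big_seq; apply: (big_ind (coprime (p ^ k p))) => [|u v pu pv|q qs].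
- exact: coprimen1.
- by rewrite coprimeMr pu.
have pq := allP pr_s q qs.
rewrite coprimeXl // coprimeXr // prime_coprime // dvdn_prime2 //.
by apply: contraNneq ps => ->.
Qed.

Lemma gfunE m' : odd m' -> gfun m' = (lcm_sum m')%:R%R.
Proof.
move=> /odd_gt0 m0; rewrite {2}(prod_prime_decomp m0) prime_decompE big_map /=.
rewrite (lcm_sum_prod _ (logn^~ m')) ?primes_uniq ?all_prime_primes //.
rewrite /gfun natr_prod; apply: eq_big_seq => p.
by rewrite mem_primes => /andP[pp _]; rewrite lcm_sum_pfactor.
Qed.

(** * Subgroups of the dicyclic group generated by [a] and [c] *)

Section Dicyclic.

Variables (gT : finGroupType) (a c : gT) (n : nat).
Hypotheses (n_gt0 : 0 < n) (oa : #[a]%g = 2 * n) (nac : (c \notin <[a]>)%g).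
Hypotheses (c2 : (c ^+ 2 = a ^+ n)%g) (ac : (a ^ c = a^-1)%g).
Local Open Scope group_scope.

Lemma flip_rotX i : c * a ^+ i = a ^- i * c.
Proof. by rewrite [RHS]conjgC conjVg conjXg ac expVgn invgK. Qed.

(** For [i = j] this says that every [a^i c] squares to [a^n], the source of the condition [d %| n]
    below. *)
Lemma mul_dic i j : (a ^+ i * c) * (a ^+ j * c) = a ^+ i * a ^- j * a ^+ n.
Proof. by rewrite mulgA -[_ * c * _]mulgA flip_rotX -c2 expgS expg1 !mulgA. Qed.

(** Powers of [a] commute with [a^d], and [c] inverts it. *)
Lemma norm_dic x d : x \in <[a]> :|: <[a]> :* c -> x \in 'N(<[a ^+ d]>).
Proof.
have nc : c \in 'N(<[a ^+ d]>).
  by rewrite -cycle_subG norms_cycle conjXg ac expVgn groupV cycle_id.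
have na y : y \in <[a]> -> y \in 'N(<[a ^+ d]>).
  move=> ya; apply: (subsetP (cent_sub _)); apply/centP => z /cycleP[k ->].
  by case/cycleP: ya => i ->; rewrite -expgM; apply: commuteX2.
case/setUP => [/na //|/rcosetP[y /na ny ->]]; exact: groupM.
Qed.

Lemma mem_cycle_expg d i : d %| 2 * n -> (a ^+ i \in <[a ^+ d]>) = (d %| i).
Proof.
move=> dN; apply/cycleP/idP => [[k /eqP]|/dvdnP[k ->]]; last first.
  by exists k; rewrite -expgM mulnC.
rewrite -expgM eq_expg_mod_order oa => /eqP E.
have : i = d * k %[mod d] by rewrite -(modn_dvdm i dN) E (modn_dvdm _ dN).
by rewrite modnMr => /eqP.
Qed.

Lemma mem_cycle_expgB d i j : d %| 2 * n ->
  (a ^+ i * a ^- j \in <[a ^+ d]>) = (i == j %[mod d]).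
Proof.
move=> dN; wlog le_ji: i j / j <= i.
  move=> W; case: (leqP j i) => [/W//|/ltnW/W E].
  by rewrite eq_sym -E -groupV invMg invgK.
by rewrite -expgnFr // mem_cycle_expg // eqn_mod_dvd.
Qed.

(** As a join this is a group at once; its form as two cosets, valid for [d %| n], is [dic_subE]. *)
Definition dic_sub d i := <[a ^+ d]> <*> <[a ^+ i * c]>.

Canonical dic_sub_group d i := Eval hnf in [group of dic_sub d i].

Lemma rot_flip_notin_cycle i : a ^+ i * c \notin <[a]>.
Proof. by rewrite groupMl ?mem_cycle. Qed.

Lemma mem_rot_flip i : a ^+ i * c \in <[a]> :|: <[a]> :* c.
Proof. by apply/setUP; right; apply/rcosetP; exists (a ^+ i); rewrite ?mem_cycle. Qed.

Lemma dic_subE d i : d %| n -> dic_sub d i = <[a ^+ d]> :|: <[a ^+ d]> :* (a ^+ i * c).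
Proof.
move=> dn; set y := a ^+ i * c.
have ny : y \in 'N(<[a ^+ d]>).
  exact: norm_dic (mem_rot_flip i).
(* This is where [d %| n] enters: [y^2 = a^n] falls back into [<a^d>], so two cosets suffice. *)
have y2 : y ^+ 2 \in <[a ^+ d]>.
  rewrite expgS expg1 mul_dic mulgV mul1g.
  by rewrite mem_cycle_expg // dvdn_mull.
rewrite /dic_sub -/y; move: y ny y2 => y ny y2.
rewrite norm_joinEr ?cycle_subG //; apply/eqP; rewrite eqEsubset; apply/andP; split.
  apply/subsetP => _ /mulsgP[u v ud /cycleP[k ->] ->].
  rewrite -(odd_double_half k) expgnDr -mul2n expgM.
  have y2k : (y ^+ 2) ^+ k./2 \in <[a ^+ d]> by rewrite groupX.
  rewrite inE; case: (odd k) => /=; last by rewrite mul1g groupM.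
  apply/orP; right; apply/rcosetP; exists (u * (y ^+ 2) ^+ k./2); first exact: groupM.
  by rewrite expg1 -[RHS]mulgA -expgM -expgSr expgS.
apply/subsetP => x /setUP[xd|/rcosetP[u ud ->]].
  by rewrite -[x]mulg1 mem_mulg.
by rewrite mem_mulg ?cycle_id.
Qed.

Lemma dic_sub_cases d i x : d %| n -> x \in dic_sub d i ->
  x \in <[a ^+ d]> \/ exists2 u, u \in <[a ^+ d]> & x = u * (a ^+ i * c).
Proof. by move=> dn; rewrite dic_subE // => /setUP[|/rcosetP]; [left|right]. Qed.

Lemma dic_subI d i : d %| n -> dic_sub d i :&: <[a]> = <[a ^+ d]>.
Proof.
move=> dn; rewrite dic_subE // setIUl.
have sda : <[a ^+ d]> \subset <[a]> by rewrite cycle_subG mem_cycle.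
rewrite (setIidPl sda); apply/setUidPl/subsetP => x /setIP[/rcosetP[u ud ->]].
by rewrite (groupMl _ (subsetP sda u ud)) (negbTE (rot_flip_notin_cycle i)).
Qed.

Lemma mem_dic_sub d i j : d %| n -> (a ^+ j * c \in dic_sub d i) = (j == i %[mod d]).
Proof.
move=> dn; have dN : d %| 2 * n by rewrite dvdn_mull.
have sda : <[a ^+ d]> \subset <[a]> by rewrite cycle_subG mem_cycle.
rewrite dic_subE // inE mem_rcoset.
rewrite (contraNF (subsetP sda _) (rot_flip_notin_cycle j)) /= invMg mulgA mulgK.
exact: mem_cycle_expgB.
Qed.

(** The intersection with [<a>] determines [d], and the elements [a^k c] of the subgroup determine
    [i] modulo [d]. *)
Lemma dic_sub_inj d i e j : d %| n -> e %| n -> i < d -> j < e ->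
  dic_sub d i = dic_sub e j -> d = e /\ i = j.
Proof.
move=> dn en id je E.
have Ede : <[a ^+ d]> = <[a ^+ e]> by rewrite -(dic_subI d i) // E dic_subI.
have de : d = e.
  have dN : d %| 2 * n by apply: dvdn_mull.
  have eN : e %| 2 * n by apply: dvdn_mull.
  apply/eqP; rewrite eqn_dvd -(mem_cycle_expg d e dN) -(mem_cycle_expg e d eN).
  by rewrite Ede cycle_id -Ede cycle_id.
split=> //; have : a ^+ i * c \in dic_sub e j by rewrite -E mem_dic_sub.
by rewrite mem_dic_sub // (modn_small je) modn_small -?de // => /eqP.
Qed.

Lemma sub_cycleE (H : {group gT}) : H \subset <[a]> -> H :=: <[a ^+ (#[a] %/ #|H|)]>.
Proof.
move=> sH.
have : H \in [set K : {group gT} | K \subset <[a]> & #|K| == #|H|] by rewrite inE sH eqxx.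
by rewrite cycle_sub_group ?cardSg // => /set1P {1}->.
Qed.

(** Write [H :&: <[a]>] as [<a^d>] and pick [y = a^k c] in [H]. Any other element of [H] outside
    [<a>] differs from [y] by an element of that intersection, so [H] is generated by [a^d] and [y],
    and [k] matters only modulo [d]. *)
Lemma dic_sub_exists (H : {group gT}) : H \subset <[a]> :|: <[a]> :* c ->
  ~~ (H \subset <[a]>) ->
  exists d i, [/\ d %| n, i < d & H :=: dic_sub d i].
Proof.
move=> sH /subsetPn[y yH yna].
have {yna} [k yE] : exists k, y = a ^+ k * c.
  have := subsetP sH y yH; rewrite inE (negbTE yna) => /= /rcosetP[u /cycleP[k ->] ->].
  by exists k.
have [K sK] : exists K : {group gT}, K :=: H :&: <[a]> by exists (H :&: <[a]>)%G.
have sKa : K \subset <[a]> by rewrite sK subsetIr.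
pose d := (#[a] %/ #|K|)%N.
have KE : K :=: <[a ^+ d]> by exact: sub_cycleE.
have dN : d %| 2 * n by rewrite -oa; apply/dvdnP; exists #|K|; rewrite mulnC divnK ?cardSg.
(* [H] contains [y^2 = a^n], hence [a^n] lies in [<a^d>]. *)
have dn : d %| n.
  rewrite -mem_cycle_expg // -KE sK inE mem_cycle andbT -c2.
  have := groupM yH yH; rewrite yE mul_dic mulgV mul1g => h.
  by rewrite c2.
have d_gt0 := dvdn_gt0 n_gt0 dn.
exists d, (k %% d)%N; split=> //; first exact: ltn_pmod.
have yD : y \in dic_sub d (k %% d) by rewrite yE mem_dic_sub // modn_mod.
have sKD : K \subset dic_sub d (k %% d) by rewrite KE joing_subl.
apply/eqP; rewrite eqEsubset; apply/andP; split.
  apply/subsetP => z zH; have := subsetP sH z zH.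
  have [za _|zna /=] := boolP (z \in <[a]>).
    by rewrite (subsetP sKD) // sK inE zH.
  rewrite inE (negbTE zna) => /= /rcosetP[u /cycleP[l ->] zE].
  rewrite -(mulgKV y z) groupM // (subsetP sKD) // sK inE groupM ?groupV //=.
  by rewrite zE yE invMg mulgA mulgK groupM ?groupV ?mem_cycle.
have sKH : K \subset H by rewrite sK subsetIl.
rewrite join_subG -KE sKH cycle_subG /=.
have -> : a ^+ (k %% d) * c = (a ^+ (k %/ d * d)) ^-1 * y.
  by apply: (canRL (mulKg _)); rewrite yE mulgA -expgnDr -divn_eq.
rewrite groupM // groupV (subsetP sKH) // KE mem_cycle_expg ?dvdn_mull //.
Qed.

(** * Which of the subgroups [dic_sub d i] permute *)

Lemma cycle_expg_gcd d e : d %| n -> e %| n ->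
  <[a ^+ d]> * <[a ^+ e]> = <[a ^+ gcdn d e]>.
Proof.
move=> dn en; have d0 := dvdn_gt0 n_gt0 dn; have e0 := dvdn_gt0 n_gt0 en.
have gN : gcdn d e %| 2 * n by rewrite (dvdn_trans (dvdn_gcdl _ _)) ?dvdn_mull.
apply/eqP; rewrite eqEsubset; apply/andP; split.
  by rewrite mul_subG // cycle_subG mem_cycle_expg ?dvdn_gcdl ?dvdn_gcdr.
(* Bezout: [u * d = v * e + gcdn d e]. *)
have [u v E _] := egcdnP e d0.
have cde : <[a ^+ d]> \subset 'N(<[a ^+ e]>).
  by rewrite cycle_subG; apply: norm_dic; rewrite inE mem_cycle.
rewrite -norm_joinEl // cycle_subG.
have -> : a ^+ gcdn d e = (a ^+ (v * e)) ^-1 * a ^+ (u * d).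
  by rewrite E expgnDr mulKg.
rewrite groupM ?groupV //.
  by rewrite (subsetP (joing_subr _ _)) // mulnC expgM mem_cycle.
by rewrite (subsetP (joing_subl _ _)) // mulnC expgM mem_cycle.
Qed.

Lemma dic_commg i j : (a ^+ i * c) * (a ^+ j * c) =
  a ^+ (2 * i) * a ^- (2 * j) * ((a ^+ j * c) * (a ^+ i * c)).
Proof.
have cij : commute (a ^- i) (a ^- j).
  by apply/commuteV/commute_sym/commuteV/commuteX2.
rewrite !mul_dic !mulgA; congr (_ * _).
by rewrite !mul2n -!addnn !expgnDr invMg !mulgA mulgKV -mulgA -cij mulgA mulgK.
Qed.

(** The congruence puts [w = a^(2i-2j)] in [<a^e><a^d>], where it can be absorbed after exchanging
    the two non-rotations. The hypothesis is symmetric, so this inclusion yields equality. *)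
Lemma dic_sub_mul_sub d i e j : d %| n -> e %| n ->
  (2 * i == 2 * j %[mod gcdn d e])%N ->
  dic_sub d i * dic_sub e j \subset dic_sub e j * dic_sub d i.
Proof.
move=> dn en ij; have gN : gcdn d e %| 2 * n.
  by rewrite (dvdn_trans (dvdn_gcdl _ _)) // dvdn_mull.
have wM : a ^+ (2 * i) * a ^- (2 * j) \in <[a ^+ e]> * <[a ^+ d]>.
  by rewrite cycle_expg_gcd // gcdnC mem_cycle_expgB.
have:= dic_commg i j; move: (_ * a ^- _) wM => w wM.
have nx := norm_dic _ e (mem_rot_flip i).
have ny := norm_dic _ d (mem_rot_flip j).
have na f k : a ^+ k \in 'N(<[a ^+ f]>) by apply: norm_dic; rewrite inE mem_cycle.
have sE : <[a ^+ e]> \subset dic_sub e j := joing_subl _ _.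
have sD : <[a ^+ d]> \subset dic_sub d i := joing_subl _ _.
have yE : a ^+ j * c \in dic_sub e j by rewrite mem_dic_sub.
have xD : a ^+ i * c \in dic_sub d i by rewrite mem_dic_sub.
have nED : <[a ^+ e]> \subset 'N(<[a ^+ d]>) by rewrite cycle_subG na.
have nDE : <[a ^+ d]> \subset 'N(<[a ^+ e]>) by rewrite cycle_subG na.
have nDE' : dic_sub d i \subset 'N(<[a ^+ e]>) by rewrite join_subG nDE cycle_subG.
have nED' : dic_sub e j \subset 'N(<[a ^+ d]>) by rewrite join_subG nED cycle_subG.
move=> xy; apply/subsetP => _ /mulsgP[h k hH kK ->].
(* A factor in [<a^e>] or [<a^d>] is carried across the other factor, which normalizes that
   subgroup. *)
have [kV|[v vV kE]] := dic_sub_cases _ _ _ en kK.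
  rewrite (conjgCV h k) mem_mulg // (subsetP sE) // memJ_norm //.
  by rewrite groupV (subsetP nDE').
have [hU|[u uU hE]] := dic_sub_cases _ _ _ dn hH.
  rewrite (conjgC h k) mem_mulg // (subsetP sD) // memJ_norm //.
  exact: (subsetP nED').
move: (a ^+ i * c) (a ^+ j * c) nx ny xD yE xy hE kE => x y nx ny xD yE xy -> ->.
have [v' v'V E] : exists2 v', v' \in <[a ^+ e]> & u * x * (v * y) = u * v' * w * (y * x).
  exists (v ^ x^-1); first by rewrite memJ_norm ?groupV.
  by rewrite -mulgA [x * _]mulgA [x * v]conjgCV -!mulgA xy !mulgA.
have : u * v' * w \in <[a ^+ e]> <*> <[a ^+ d]>.
  apply: groupM; last by rewrite /= norm_joinEr.
  by apply: groupM; [exact: (subsetP (joing_subr _ _)) | exact: (subsetP (joing_subl _ _))].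
(* Sort [u v' w] as [v1 u1] with [v1] in [<a^e>] and [u1] in [<a^d>], then move [u1] past [y]: the
   product becomes [v1 y] times [u1^y x]. *)
rewrite norm_joinEr // => /mulsgP[v1 u1 v1V u1U E1].
rewrite E E1 -mulgA [u1 * _]mulgA (conjgC u1 y) -mulgA mulgA mem_mulg //.
  by rewrite groupM // (subsetP sE).
by rewrite groupM // (subsetP sD) // memJ_norm.
Qed.

Lemma dic_sub_comm d i e j : d %| n -> e %| n ->
  (dic_sub d i * dic_sub e j == dic_sub e j * dic_sub d i) =
  (2 * i == 2 * j %[mod gcdn d e])%N.
Proof.
move=> dn en; apply/idP/idP => [/eqP comm|ij]; last first.
  by rewrite eqEsubset !dic_sub_mul_sub // gcdnC eq_sym.
have gN : gcdn d e %| 2 * n by rewrite (dvdn_trans (dvdn_gcdl _ _)) // dvdn_mull.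
have ny := norm_dic _ d (mem_rot_flip j).
have yE : a ^+ j * c \in dic_sub e j by rewrite mem_dic_sub.
have xD : a ^+ i * c \in dic_sub d i by rewrite mem_dic_sub.
have nED : <[a ^+ e]> \subset 'N(<[a ^+ d]>).
  by rewrite cycle_subG; apply: norm_dic; rewrite inE mem_cycle.
have mulM u v : u \in <[a ^+ e]> -> v \in <[a ^+ d]> -> u * v \in <[a ^+ gcdn d e]>.
  by move=> ue vd; rewrite gcdnC -cycle_expg_gcd // mem_mulg.
have sda f : <[a ^+ f]> \subset <[a]> by rewrite cycle_subG mem_cycle.
have xya : (a ^+ i * c) * (a ^+ j * c) \in <[a]>.
  by rewrite mul_dic !groupM ?groupV ?mem_cycle.
have : (a ^+ i * c) * (a ^+ j * c) \in dic_sub e j * dic_sub d i.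
  by rewrite -comm mem_mulg.
case/mulsgP => k h /(dic_sub_cases _ _ _ en)[kV|[v vV kE]]
  /(dic_sub_cases _ _ _ dn)[hU|[u uU hE]] E.
(* The product lies in [<a>], so the mixed cases are contradictory. Here both factors are in [<a>]:
   [a^(i-j+n)] lies in [<a^g>], [g] the gcd, and [g] divides [n], so even [i = j] modulo [g]. *)
- have := mulM _ _ kV hU; rewrite -E mul_dic groupMr; last first.
    by rewrite mem_cycle_expg // (dvdn_trans (dvdn_gcdl _ _)).
  by rewrite mem_cycle_expgB // => ij; rewrite -modnMmr (eqP ij) modnMmr.
- move: xya; rewrite E hE mulgA groupMl ?(negbTE (rot_flip_notin_cycle i)) //.
  by rewrite groupM ?(subsetP (sda e) k) ?(subsetP (sda d) u).
- move: xya; rewrite E kE -mulgA groupMl ?(subsetP (sda e) v) //.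
  by rewrite groupMr ?(subsetP (sda d) h) // (negbTE (rot_flip_notin_cycle j)).
(* Both factors outside [<a>]: cancelling the common right factor exhibits [a^(2i-2j)] as an element
   of [<a^e><a^d>]. *)
have E2 : v * (a ^+ j * c) * (u * (a ^+ i * c)) =
  v * u ^ (a ^+ j * c)^-1 * (a ^+ j * c * (a ^+ i * c)).
  by move: (a ^+ j * c) => y; rewrite conjgE invgK !mulgA mulgKV.
move: E; rewrite kE hE dic_commg E2 => /mulIg E.
by rewrite -mem_cycle_expgB // E mulM // memJ_norm ?groupV.
Qed.

(** * Counting subgroups and permuting pairs *)

Lemma dicE : <[a]> <*> <[c]> = <[a]> :|: <[a]> :* c.
Proof. by have := dic_subE 1 0 (dvd1n n); rewrite /dic_sub expg0 mul1g !expg1. Qed.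

Lemma dic_sub_subset d i : dic_sub d i \subset <[a]> <*> <[c]>.
Proof.
rewrite /dic_sub join_subG !cycle_subG /= dicE mem_rot_flip andbT inE.
by rewrite mem_cycle.
Qed.

Lemma subgroups_dic_perm :
  perm_eq [seq H : {group gT} <- enum (subgroups (<[a]> <*> <[c]>)) | ~~ (H \subset <[a]>)]
          [seq (dic_sub_group d i : {group gT}) | d <- divisors n, i <- iota 0 d].
Proof.
apply: uniq_perm.
- by rewrite filter_uniq // enum_uniq.
- apply: allpairs_uniq_dep; [exact: divisors_uniq | by move=> d _; exact: iota_uniq |].
  move=> _ _ /allpairsPdep[d [i [dn id ->]]] /allpairsPdep[e [j [en je ->]]].
  rewrite /= => /(congr1 val) /= E.
  move: dn en id je; rewrite -!dvdn_divisors // !mem_iota !add0n => dn en id je.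
  by have [-> ->] := dic_sub_inj _ _ _ _ dn en id je E.
move=> H; rewrite mem_filter mem_enum inE dicE; apply/andP/allpairsPdep.
  case=> nH sH; have [d [i [dn id HE]]] := dic_sub_exists _ sH nH.
  exists d, i; rewrite -dvdn_divisors // mem_iota add0n; split=> //.
  exact: val_inj.
case=> d [i []]; rewrite -dvdn_divisors // mem_iota add0n => dn /= id ->; split.
  apply: contra (rot_flip_notin_cycle i) => /subsetP; apply.
  by rewrite /= mem_dic_sub.
by rewrite -dicE dic_sub_subset.
Qed.

Lemma comm_sub_cycle (H K : {group gT}) : H \subset <[a]> ->
  K \subset <[a]> <*> <[c]> -> H * K = K * H.
Proof.
move=> /sub_cycleE HE sK; apply/esym/normC; rewrite HE.
by apply/subsetP => x /(subsetP sK); rewrite dicE; apply: norm_dic.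
Qed.

(** Used with a constant [F] to count subgroups, and in each coordinate to count permuting pairs. *)
Lemma big_subgroups_dic (F : {group gT} -> nat) :
  (\sum_(H in subgroups (<[a]> <*> <[c]>)) F H =
   \sum_(H in subgroups <[a]>) F H +
   \sum_(d <- divisors n) \sum_(i < d) F (dic_sub_group d i))%N.
Proof.
rewrite (bigID (fun H : {group gT} => H \subset <[a]>)) /=; congr addn.
  apply: eq_bigl => H; rewrite !inE andbC; case: (boolP (H \subset _)) => //= sH.
  by rewrite (subset_trans sH) ?joing_subl.
rewrite -big_enum_cond -big_filter (perm_big _ subgroups_dic_perm) big_allpairs_dep.
apply: eq_bigr => d _.
by rewrite -(big_mkord xpredT (fun i => F (dic_sub_group d i))) /index_iota subn0.
Qed.

(** A subgroup of a cyclic group is determined by its order, which can be any divisor of [2 * n]. *)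
Lemma card_subgroups_cycle : #|subgroups <[a]>| = tau (2 * n).
Proof.
rewrite /tau cardE -(size_map (fun H : {group gT} => #|H|)) -oa.
apply/perm_size/uniq_perm; rewrite ?divisors_uniq //.
  rewrite map_inj_in_uniq ?enum_uniq // => H K; rewrite !mem_enum !inE => Ha Ka E.
  by apply/val_inj/eqP; rewrite /= (eq_subG_cyclic (cycle_cyclic a)) // E.
move=> d; rewrite -dvdn_divisors ?order_gt0 //; apply/mapP/idP => [[H]|da].
  by rewrite mem_enum inE => Ha ->; apply: cardSg.
have : <[a ^+ (#[a] %/ d)]>%G \in [set H : {group gT} | H \subset <[a]> & #|H| == d].
  by rewrite cycle_sub_group // inE.
rewrite inE => /andP[sa /eqP cd]; exists <[a ^+ (#[a] %/ d)]>%G => //.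
by rewrite mem_enum inE.
Qed.

Lemma card_subgroups_dic :
  #|subgroups (<[a]> <*> <[c]>)| = (tau (2 * n) + sigma n)%N.
Proof.
rewrite -sum1_card big_subgroups_dic sum1_card card_subgroups_cycle; congr addn.
by apply: eq_bigr => d _; rewrite sum1_card card_ord.
Qed.

Lemma card_comm_pairs_dic :
  #|[set HK in setX (subgroups (<[a]> <*> <[c]>)) (subgroups (<[a]> <*> <[c]>))
      | (HK.1 : {set gT}) * HK.2 == HK.2 * HK.1]| =
  (tau (2 * n) ^ 2 + 2 * tau (2 * n) * sigma n +
   \sum_(d <- divisors n) \sum_(e <- divisors n)
     \sum_(i < d) \sum_(j < e) (2 * i == 2 * j %[mod gcdn d e]))%N.
Proof.
set L := subgroups _; pose comm (H K : {set gT}) := H * K == K * H.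
transitivity (\sum_(H in L) \sum_(K in L) (comm H K : nat))%N.
  under [RHS]eq_bigr do rewrite -big_mkcondr.
  rewrite pair_big_dep /= -sum1_card; apply: eq_bigl => -[H K].
  by rewrite inE in_setX -andbA.
(* Rows with [H] inside [<a>]: every subgroup permutes with [H]. *)
rewrite big_subgroups_dic (eq_bigr (fun=> tau (2 * n) + sigma n)%N); last first.
  move=> H; rewrite inE => sH.
  rewrite (eq_bigr (fun=> 1%N)) ?sum1_card ?card_subgroups_dic // => K; rewrite inE => sK.
  by rewrite /comm comm_sub_cycle ?eqxx.
rewrite sum_nat_const card_subgroups_cycle.
(* Rows with [H = dic_sub d i]: each of the [d] values of [i] contributes [tau (2 * n)] from the
   subgroups of [<a>]; summed over [d], this gives the second [tau (2 * n) * sigma n]. *)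
rewrite (eq_big_seq (fun d => d * tau (2 * n) + \sum_(e <- divisors n)
     \sum_(i < d) \sum_(j < e) (2 * i == 2 * j %[mod gcdn d e]))%N); last first.
  move=> d; rewrite -dvdn_divisors // => dn.
  rewrite [X in (_ + X)%N]exchange_big /= -[X in (X * _)%N]card_ord -sum_nat_const -big_split /=.
  apply: eq_bigr => i _; rewrite big_subgroups_dic; congr addn.
    rewrite (eq_bigr (fun=> 1%N)) ?sum1_card ?card_subgroups_cycle // => K; rewrite inE => sK.
    rewrite /comm eq_sym comm_sub_cycle ?eqxx //.
    exact: dic_sub_subset.
  apply: eq_big_seq => e; rewrite -dvdn_divisors // => en.
  by apply: eq_bigr => j _; rewrite /comm dic_sub_comm.
rewrite big_split /= -big_distrl /= -/(sigma n).
lia.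
Qed.

End Dicyclic.

(** * A permutation model of the presentation, of order at least [4 * n] *)

Section DicyclicModel.

Variable n : nat.
Hypothesis n_gt0 : 0 < n.
Local Notation T := ('Z_(2 * n) * bool)%type.
Local Open Scope ring_scope.

(* Right multiplications by [a] and [c] on the words [a^x c^b], encoded as [(x, b)]. *)
Definition dic_rot_fun (z : T) : T := (if z.2 then z.1 - 1 else z.1 + 1, z.2).
Definition dic_flip_fun (z : T) : T := (if z.2 then z.1 + n%:R else z.1, ~~ z.2).

Lemma dic_rot_inj : injective dic_rot_fun.
Proof. by move=> [x b] [y e] [] /= /[swap] <-; case: b => /addIr ->. Qed.

Lemma dic_flip_inj : injective dic_flip_fun.
Proof. by move=> [x b] [y e] [] /= /[swap] /negb_inj <-; case: b => [/addIr|] ->. Qed.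

Definition dic_rot := perm dic_rot_inj.
Definition dic_flip := perm dic_flip_inj.

Lemma dic_rotX k x b :
  (dic_rot ^+ k)%g (x, b) = (if b then x - k%:R else x + k%:R, b).
Proof.
elim: k => [|k IHk]; first by rewrite expg0 perm1 subr0 addr0 if_same.
by rewrite expgSr permM IHk permE /dic_rot_fun /= -natr1; case: (b); rewrite ?opprD addrA.
Qed.

Lemma Zp_nat_double : n%:R + n%:R = 0 :> 'Z_(2 * n).
Proof. by rewrite -natrD addnn -mul2n pchar_Zp //; lia. Qed.

Lemma dic_model :
  (<[dic_rot]> <*> <[dic_flip]> \homg
    Grp (a : c : a ^+ (2 * n) = 1, c ^+ 2 = a ^+ n, a ^ c = a^-1))%g.
Proof.
(* [a^n] adds or subtracts [n] according to the second coordinate, while [c^2] always adds it. *)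
have oppn : - n%:R = n%:R :> 'Z_(2 * n) by apply/eqP; rewrite eq_sym -addr_eq0 Zp_nat_double.
apply/existsP; exists (dic_rot, dic_flip); rewrite /= !xpair_eqE eqxx /=.
apply/and3P; split; apply/eqP.
- apply/permP => -[x b]; rewrite dic_rotX perm1 pchar_Zp; last by lia.
  by rewrite subr0 addr0 if_same.
- apply/permP => -[x b]; rewrite dic_rotX expgS expg1 permM !permE /dic_flip_fun /=.
  by case: b; rewrite /= ?oppn.
(* The relation is recast as [a c a = c], free of inverse permutations. *)
apply: (mulgI dic_flip); rewrite conjgE mulKVg; apply: (mulIg dic_rot).
rewrite mulgKV; apply/permP => -[x b]; rewrite !permM !permE /dic_flip_fun /dic_rot_fun /=.
by case: b; rewrite /= ?addrK // addrAC subrK.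
Qed.

Lemma card_dic_model : (4 * n <= #|<[dic_rot]> <*> <[dic_flip]>|)%g%N.
Proof.
have -> : (4 * n = #|[set: T]|)%N.
  rewrite cardsT card_prod card_bool card_ord Zp_cast; first by lia.
  by lia.
have mr : (dic_rot \in <[dic_rot]> <*> <[dic_flip]>)%g.
  by rewrite (subsetP (joing_subl _ _)) ?cycle_id.
have mf : (dic_flip \in <[dic_rot]> <*> <[dic_flip]>)%g.
  by rewrite (subsetP (joing_subr _ _)) ?cycle_id.
(* The orbit of [(0, false)] is everything: [a^x c^b] sends it to [(x, b)]. *)
apply: leq_trans (leq_imset_card (fun s : {perm T} => s (0, false)) _).
apply/subset_leq_card/subsetP => -[x b] _; apply/imsetP.
exists (dic_rot ^+ x * dic_flip ^+ b)%g; first by rewrite groupM ?groupX.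
rewrite permM dic_rotX add0r natr_Zp; case: b; last by rewrite expg0 perm1.
by rewrite expg1 permE.
Qed.

End DicyclicModel.

(** * From the presentation to the formula *)

Lemma dic_generators (gT : finGroupType) (G : {group gT}) (n : nat) : 0 < n ->
  (G \isog Grp (a : c : a ^+ (2 * n) = 1, c ^+ 2 = a ^+ n, a ^ c = a^-1))%g ->
  exists a c : gT, [/\ #[a] = (2 * n)%N, c \notin <[a]>, c ^+ 2 = a ^+ n,
    a ^ c = a^-1 & <[a]> <*> <[c]> = G]%g.
Proof.
move=> n_gt0 isoG.
(* The model is a homomorphic image of [G], so its order bounds that of [G] from below. *)
have leG : (4 * n <= #|G|)%N.
  apply: leq_trans (card_dic_model _ n_gt0) _; apply: dvdn_leq => //.
  by apply: card_homg; rewrite isoG dic_model.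
have /existsP[[a c] /= /eqP[GE aN c2 ac]] := isoGrp_hom isoG.
have GE' : (<[a]> * <[c]> = G)%g.
  by rewrite -norm_joinEr // norms_cycle ac groupV cycle_id.
have oN : #[a]%g <= 2 * n by rewrite dvdn_leq ?muln_gt0 // order_dvdn aN.
(* Otherwise [G = <a>] would have order at most [2 * n]. *)
have nac : (c \notin <[a]>)%g.
  apply/negP => ca; have : #|G| = #[a]%g by rewrite -GE' mulGSid ?cycle_subG.
  by lia.
exists a, c; split=> //.
apply/eqP; rewrite eqn_leq oN /=.
have /= := mul_cardG <[a]>%G <[c]>%G; rewrite GE' -!orderE => E.
(* [c^2 = a^n] lies in both cyclic groups, so their intersection has index at most 2 in [<c>]. With
   the product formula and [4 * n <= #|G|], this forces [#[a] >= 2 * n]. *)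
have le_c : #[c]%g <= 2 * #|(<[a]> :&: <[c]>)%g|.
  rewrite dvdn_leq ?muln_gt0 ?cardG_gt0 // order_dvdn expgM -order_dvdn.
  by apply: order_dvdG; rewrite inE {1}c2 !mem_cycle.
rewrite -(leq_pmul2r (order_gt0 c)) E.
apply: leq_trans (leq_mul leG (leqnn _)).
by rewrite (leq_trans (leq_mul (leqnn _) le_c)) // mulnCA !mulnA.
Qed.

(* G is (isomorphic to) Dic_{4n} = < a, c | a^(2n) = 1, c^2 = a^n, c^-1 a c = a^-1 > *)
Theorem theorem2p1 (gT : finGroupType) (G : {group gT}) (n m m' : nat) :
  (0 < n)%N -> odd m' -> n = (2 ^ m * m')%N ->
  (G \isog Grp (a : c : a ^+ (2 * n) = 1, c ^+ 2 = a ^+ n, a ^ c = a^-1))%g ->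
  sd G =
  ((((m + 2) ^ 2 * tau m' ^ 2 + 2 * (m + 2) * tau m' * sigma n)%:R
     + (((m%:R - 1) * (2 ^ (m + 3))%:R + 9) * gfun m')
   ) / (((m + 2) * tau m' + sigma n) ^ 2)%:R)%R.
Proof.
move=> n_gt0 om nE isoG.
have [a [c [oa nac c2 ac GE]]] := dic_generators _ _ _ n_gt0 isoG.
(* [2 * n] is [2 ^ m.+1 * m'], and [2 ^ m.+1] has [m + 2] divisors. *)
have tau2n : tau (2 * n) = (m + 2) * tau m'.
  rewrite nE mulnA -expnS tauM ?tau_pfactor ?addn2 //.
  - by rewrite expn_gt0.
  - exact: odd_gt0.
  - by rewrite coprimeXl // coprime2n.
rewrite /sd -{1 2 3}GE.
rewrite (card_comm_pairs_dic _ a c n) // (card_subgroups_dic _ a c n) // tau2n.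
congr (_ / _)%R; rewrite natrD; congr (_ + _)%R.
  by rewrite expnMn !mulnA.
(* The bracket is [dbl_lcm_sum (2 ^ m)] and [gfun m'] is [lcm_sum m']; their product is
   [dbl_lcm_sum n], compared with the count for each pair [d], [e]. *)
rewrite gfunE // -dbl_lcm_sum_pow2E -natrM -dbl_lcm_sumM // -nE; congr (_%:R)%R.
apply: eq_big_seq => d; rewrite -dvdn_divisors // => dn.
apply: eq_big_seq => e; rewrite -dvdn_divisors // => en.
by rewrite sum_eqmod_double ?(dvdn_gt0 n_gt0).
Qed.
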